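(* For every real number $x>0$, $$\exp\left[x\,\psi\left(\frac{x}{\log(x+1)}\right)\right]\leq\Gamma(x+1)\leq\exp\left[x\,\psi\left(\frac{x}{2}+1\right)\right].$$
   Context: $\Gamma(x)=\int_0^\infty u^{x-1}e^{-u}\,du$ for real $x>0$ is the gamma function, $\psi(x)=\Gamma'(x)/\Gamma(x)$ for $x>0$ is the digamma function, and $\log$ is the natural logarithm. *)

(* Defs.v *)
From mathcomp Require Import all_boot all_order all_algebra.
From mathcomp Require Import all_classical all_reals all_analysis.

Set Implicit Arguments.
Unset Strict Implicit.
Unset Printing Implicit Defensive.

Import Order.TTheory GRing.Theory Num.Theory.
Import numFieldNormedType.Exports.

Local Open Scope classical_set_scope.
Local Open Scope ring_scope.

(* Both functions are total: their values are meaningful for [0 < x] only. *)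
Definition Gamma {R : realType} (x : R) : R :=
  \int[lebesgue_measure]_(u in `]0, +oo[) (u `^ (x - 1) * expR (- u)).

Definition digamma {R : realType} (x : R) : R :=
  derive1 Gamma x / Gamma x.

(* Main.v *)
Require Import Defs.
From HB Require Import structures.
From mathcomp Require Import all_boot all_order all_algebra.
From mathcomp Require Import ring lra zify.
From mathcomp Require Import all_classical all_reals all_analysis.

Import Order.TTheory GRing.Theory Num.Theory.
Import numFieldNormedType.Exports.

Local Open Scope ring_scope.

Set Implicit Arguments.
Unset Strict Implicit.
Unset Printing Implicit Defensive.

(* By Euler's limits,
     ln Gamma(x + 1) = lim (x ln n - sum_(k < n) (ln (x + 1 + k) - ln (1 + k))),
     psi(y) = lim (ln n - sum_(k < n) 1 / (y + k)),
   so each bound reduces to a comparison, for every [k], of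
   ln (x + 1 + k) - ln (1 + k), the integral of 1 / (t + 1 + k) over [0, x], with
   x / (y + k): the midpoint rule for convex functions when y = x / 2 + 1, and
   Jensen's inequality in the variable 1 / (t + 1) when y = x / ln (x + 1).

   Euler's limit for Gamma follows from the functional equation and from
   a^p Gamma(a) <= Gamma(a + p) for p <= 0 or p >= 1. Both are obtained on the
   compact intervals [1 / n, n] and passed to the limit by monotone convergence.
   The limit for psi needs no differentiation under the integral sign: by Euler's
   limit for Gamma, the first-order remainder of ln Gamma is quadratic. *)

(** * Tangent-line inequalities for powers *)

Lemma ln_le_subr1 {R : realType} (u : R) : 0 < u -> ln u <= u - 1.
Proof.
move=> u0; rewrite -[in leLHS](subrK 1 u) addrC.
by apply: le_ln1Dx; lra.
Qed.

(* For [1 <= p], write [u `^ p = u * (u^-1) `^ (1 - p)] and use the case of a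
   nonpositive exponent. *)
Lemma powR_ge_tangent1 {R : realType} (p u : R) :
  (p <= 0) || (1 <= p) -> 0 < u -> 1 + p * (u - 1) <= u `^ p.
Proof.
have main (q v : R) : q <= 0 -> 0 < v -> 1 + q * (v - 1) <= v `^ q.
  move=> q0 v0; rewrite /powR gt_eqF//.
  apply: le_trans (expR_ge1Dx _); rewrite lerD2l.
  by apply: ler_wnM2l => //; exact: ln_le_subr1.
case/orP => hp u0; first exact: main.
have iu : 0 < u^-1 by rewrite invr_gt0.
have p1 : 1 - p <= 0 by rewrite subr_le0.
have /(ler_wpM2l (ltW u0)) := main _ _ p1 iu.
have -> : u * u^-1 `^ (1 - p) = u `^ p.
  rewrite -powR_inv1 ?ltW// -powRrM -{1}[u]powRr1 ?ltW// -powRD ?(gt_eqF u0) ?implybT//.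
  by congr powR; ring.
have -> // : u * (1 + (1 - p) * (u^-1 - 1)) = 1 + p * (u - 1).
by field; rewrite gt_eqF.
Qed.

Lemma powR_ge_tangent {R : realType} (p a u : R) :
  (p <= 0) || (1 <= p) -> 0 < a -> 0 < u ->
  a `^ p * (1 - p) + a `^ p * (p / a) * u <= u `^ p.
Proof.
move=> hp a0 u0.
have ua : 0 < u / a by rewrite divr_gt0.
have -> : u `^ p = a `^ p * (u / a) `^ p.
  by rewrite -powRM ?ltW// mulrC divfK// gt_eqF.
rewrite -mulrA -mulrDr ler_pM2l ?powR_gt0//.
apply: le_trans (powR_ge_tangent1 hp ua).
by rewrite le_eqVlt; apply/orP; left; apply/eqP; ring.
Qed.

(** * The Gamma integral over compact intervals *)

Section truncated_Gamma.
Context {R : realType}.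
Implicit Types (a p u : R) (n : nat).
Local Notation mu := (@lebesgue_measure R).
Local Open Scope classical_set_scope.

Definition Gamma_kernel a u : R := u `^ (a - 1) * expR (- u).

(** The shift by 2 keeps the endpoints distinct already at [n = 0], as the fundamental theorem of
    calculus requires below. *)
Definition Gamma_itv n : set R := `[(n.+2%:R)^-1, n.+2%:R].

Definition truncated_Gamma n a : R :=
  \int[mu]_(u in Gamma_itv n) Gamma_kernel a u.

Lemma Gamma_itv_gt0 n u : Gamma_itv n u -> 0 < u.
Proof.
rewrite /Gamma_itv/= in_itv/= => /andP[h _].
by apply: lt_le_trans h; rewrite invr_gt0 ltr0n.
Qed.

Lemma measurable_Gamma_itv n : measurable (Gamma_itv n : set (measurableTypeR R)).
Proof. exact: measurable_itv. Qed.

Lemma Gamma_kernel_ge0 a u : 0 <= Gamma_kernel a u.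
Proof. by rewrite mulr_ge0 ?powR_ge0 ?expR_ge0. Qed.

Lemma Gamma_kernelD a p u : 0 < u ->
  Gamma_kernel (a + p) u = u `^ p * Gamma_kernel a u.
Proof.
move=> u0; rewrite /Gamma_kernel mulrA -powRD ?(gt_eqF u0) ?implybT//.
by congr (_ `^ _ * _); ring.
Qed.

Lemma Gamma_kernelD1 a u : 0 < u ->
  Gamma_kernel (a + 1) u = u * Gamma_kernel a u.
Proof. by move=> u0; rewrite Gamma_kernelD// powRr1 ?ltW. Qed.

Lemma is_derive_Gamma_kernel a u : 0 < u ->
  is_derive u 1 (Gamma_kernel (a + 1)) (a * Gamma_kernel a u - Gamma_kernel (a + 1) u).
Proof.
move=> u0.
have dpow := is_derive1_powR (a + 1 - 1) u0.
have dexp : is_derive u 1 (fun v : R => expR (- v)) (expR (- u) * -1).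
  by apply: (@is_derive1_comp _ expR -%R); exact: is_derive_expR.
apply: (is_derive_eq (is_deriveM dpow dexp)).
by rewrite /Gamma_kernel !addrK /GRing.scale/=; ring.
Qed.

Lemma continuous_Gamma_kernel a u : 0 < u -> {for u, continuous (Gamma_kernel a)}.
Proof.
move=> u0; rewrite -[a](subrK 1).
apply: differentiable_continuous; apply/derivable1_diffP.
by have [] := is_derive_Gamma_kernel (a - 1) u0.
Qed.

Lemma within_continuous_Gamma_kernel n a :
  {within Gamma_itv n, continuous (Gamma_kernel a)}.
Proof.
apply: continuous_in_subspaceT => u; rewrite inE => /Gamma_itv_gt0.
exact: continuous_Gamma_kernel.
Qed.

Lemma integrable_Gamma_kernel n a :
  mu.-integrable (Gamma_itv n) (EFin \o Gamma_kernel a).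
Proof.
apply: continuous_compact_integrable; first exact: segment_compact.
exact: within_continuous_Gamma_kernel.
Qed.

Lemma integrable_Gamma_kernelZ n a c :
  mu.-integrable (Gamma_itv n) (EFin \o (fun u => c * Gamma_kernel a u)).
Proof.
have := integrableZl (@measurable_Gamma_itv n) c (@integrable_Gamma_kernel n a).
by congr (_.-integrable _ _); apply/funext => u; rewrite /= EFinM.
Qed.

(** Boundary term of the integration by parts over [Gamma_itv n]. *)
Definition Gamma_defect n a : R :=
  Gamma_kernel (a + 1) n.+2%:R^-1 - Gamma_kernel (a + 1) n.+2%:R.

Lemma truncated_GammaD1 n a : truncated_Gamma n (a + 1) =
  a * truncated_Gamma n a + Gamma_defect n a.
Proof.
rewrite /Gamma_defect.
have n20 : (0 : R) < n.+2%:R by rewrite ltr0n.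
have in20 : (0 : R) < n.+2%:R^-1 by rewrite invr_gt0.
have ab : (n.+2%:R^-1 : R) < n.+2%:R.
  by rewrite (@lt_trans _ _ 1)// ?invf_lt1// ltr1n.
have cont c : 0 < c -> {for c, continuous (Gamma_kernel (a + 1))}.
  exact: continuous_Gamma_kernel.
have mI := @measurable_Gamma_itv n.
have iI := @integrable_Gamma_kernel n.
have FTC : (\int[mu]_(u in Gamma_itv n)
    (a * Gamma_kernel a u - Gamma_kernel (a + 1) u)%:E =
    (Gamma_kernel (a + 1) n.+2%:R)%:E - (Gamma_kernel (a + 1) n.+2%:R^-1)%:E)%E.
  apply: (continuous_FTC2 ab).
  - apply: continuous_in_subspaceT => u; rewrite inE => /Gamma_itv_gt0 u0.
    apply: cvgB; last exact: cont.
    by apply: cvgM; [exact: cvg_cst|exact: continuous_Gamma_kernel].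
  - split.
    + move=> u; rewrite in_itv/= => /andP[u0 _].
      by have [] := is_derive_Gamma_kernel a (lt_trans in20 u0).
    + exact: cvg_at_right_filter (cont _ in20).
    + exact: cvg_at_left_filter (cont _ n20).
  - move=> u; rewrite in_itv/= => /andP[u0 _].
    have h := is_derive_Gamma_kernel a (lt_trans in20 u0).
    by rewrite derive1E derive_val.
suff: a * truncated_Gamma n a - truncated_Gamma n (a + 1) =
  Gamma_kernel (a + 1) n.+2%:R - Gamma_kernel (a + 1) n.+2%:R^-1 by lra.
rewrite /truncated_Gamma -RintegralZl// -RintegralB//.
  by rewrite /Rintegral FTC.
exact: integrable_Gamma_kernelZ.
Qed.

(** The tangent in [powR_ge_tangent] is affine in [u]; integrated against [Gamma_kernel a], its
    linear term becomes an integral at [a + 1]. *)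
Lemma truncated_Gamma_tangent n a p : (p <= 0) || (1 <= p) -> 0 < a ->
  a `^ p * (1 - p) * truncated_Gamma n a +
  a `^ p * (p / a) * truncated_Gamma n (a + 1) <= truncated_Gamma n (a + p).
Proof.
move=> hp a0; rewrite /truncated_Gamma.
have mI := measurable_Gamma_itv n.
have iI := integrable_Gamma_kernel n.
have iZ := @integrable_Gamma_kernelZ n.
rewrite -!RintegralZl// -RintegralD//.
apply: le_Rintegral => //.
  exact: (integrableD mI (iZ _ _) (iZ _ _)).
move=> u /Gamma_itv_gt0 u0.
rewrite Gamma_kernelD1// Gamma_kernelD// [_ * (u * _)]mulrA -mulrDl.
by rewrite ler_wpM2r ?Gamma_kernel_ge0// powR_ge_tangent.
Qed.

End truncated_Gamma.

(** * Passage from the compact intervals to Gamma *)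

Section Gamma_limit.
Context {R : realType}.
Implicit Types (a p u : R) (n : nat).
Local Notation mu := (@lebesgue_measure R).
Local Open Scope classical_set_scope.

Lemma cvg_invSS : (n.+2%:R^-1 : R) @[n --> \oo] --> 0.
Proof.
have := @cvg_harmonic R; rewrite -(@cvg_shiftS R); exact.
Qed.

Lemma cvg_Gamma_kernel_invSS a : 0 < a ->
  Gamma_kernel (a + 1) (n.+2%:R^-1 : R) @[n --> \oo] --> 0.
Proof.
move=> a0.
have /cvg_at_rightP pow0 := powR_cvg0 a0.
have {}pow0 : (n.+2%:R^-1 : R) `^ a @[n --> \oo] --> 0.
  by apply: pow0; split; [move=> n; rewrite invr_gt0 ltr0n|exact: cvg_invSS].
apply: (squeeze_cvgr _ (@cvg_cst R 0 _ _ _) pow0).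
near=> n; rewrite Gamma_kernel_ge0/= /Gamma_kernel addrK.
by rewrite ler_piMr ?powR_ge0// -expR0 ler_expR oppr_le0 invr_ge0 ler0n.
Unshelve. all: by end_near. Qed.

Lemma cvg_Gamma_kernelSS a : 0 <= a ->
  Gamma_kernel (a + 1) (n.+2%:R : R) @[n --> \oo] --> 0.
Proof.
move=> a0.
(* Since [a] may be 0, the positive exponent [c] replaces it. Then [ln v <= v - 1] at
   [v = u / (2 * c)] bounds the kernel by a constant times [expR (- (u / 2))], which is at most
   [2 / u]. *)
pose c := a + 1; have c0 : 0 < c by rewrite ltr_wpDl.
pose C := expR (c * (ln (2 * c) - 1)) * 2.
have lim0 : C * (n.+2%:R^-1 : R) @[n --> \oo] --> 0.
  by rewrite -(mulr0 C); apply: cvgM; [exact: cvg_cst|exact: cvg_invSS].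
apply: (squeeze_cvgr _ (@cvg_cst R 0 _ _ _) lim0).
near=> n; rewrite Gamma_kernel_ge0/= /Gamma_kernel addrK.
set u : R := n.+2%:R.
have u1 : 1 <= u by rewrite ler1n.
have u0 : 0 < u by exact: lt_le_trans u1.
have lnu0 : 0 <= ln u by exact: ln_ge0.
rewrite /powR gt_eqF// -expRD.
have lnu : ln u <= u / (2 * c) - 1 + ln (2 * c).
  have -> : ln u = ln (u / (2 * c)) + ln (2 * c).
    by rewrite -lnM ?posrE ?divr_gt0 ?mulr_gt0// divfK// gt_eqF// mulr_gt0.
  by rewrite lerD2r ln_le_subr1// divr_gt0// mulr_gt0.
have bound : a * ln u - u <= c * (ln (2 * c) - 1) - u / 2.
  have h1 : a * ln u <= c * ln u by rewrite ler_wpM2r// /c lerDl.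
  have h2 : c * ln u <= c * (u / (2 * c) - 1 + ln (2 * c)) by rewrite ler_pM2l.
  have h3 : c * (u / (2 * c)) = u / 2 by field; rewrite gt_eqF.
  by move: h2; rewrite mulrDr mulrBr h3 mulrBr; lra.
apply: (@le_trans _ _ (expR (c * (ln (2 * c) - 1) - u / 2))).
  by rewrite ler_expR.
rewrite expRD /C -mulrA ler_pM2l ?expR_gt0// expRN -(invf_div u 2).
rewrite lef_pV2 ?posrE ?expR_gt0 ?divr_gt0//.
by have := expR_ge1Dx (u / 2); lra.
Unshelve. all: by end_near. Qed.

Lemma cvg_Gamma_defect a : 0 < a -> Gamma_defect n a @[n --> \oo] --> 0.
Proof.
move=> a0; rewrite -(subrr 0).
by apply: cvgB; [exact: cvg_Gamma_kernel_invSS|exact/cvg_Gamma_kernelSS/ltW].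
Qed.

(** The functional equation at [a = 0], where only the boundary term survives. *)
Lemma truncated_Gamma1 n : truncated_Gamma n 1 =
  expR (- (n.+2%:R^-1)) - Gamma_kernel 1 n.+2%:R :> R.
Proof.
have := @truncated_GammaD1 R n 0; rewrite mul0r !add0r => ->.
by rewrite /Gamma_defect add0r {1}/Gamma_kernel subrr powRr0 mul1r.
Qed.

(* The tangent inequality bounds the case [1 <= a] by the case [a = 1], and the
   functional equation then bounds [0 < a < 1] by [a + 1]. *)
Lemma truncated_Gamma_bounded a : 0 < a ->
  exists C : R, forall n, truncated_Gamma n a <= C.
Proof.
move=> a0.
have b1 n : truncated_Gamma n 1 <= 1 :> R.
  rewrite truncated_Gamma1 lerBlDr; apply: (@le_trans _ _ 1).
    by rewrite -[leRHS]expR0 ler_expR oppr_le0 invr_ge0 ler0n.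
  by rewrite lerDl Gamma_kernel_ge0.
have defect_bounded (c : R) : 0 < c -> exists C : R, forall n, `|Gamma_defect n c| <= C.
  move=> c0.
  have /cvg_seq_bounded : cvgn (Gamma_defect ^~ c).
    by apply/cvg_ex; exists 0; exact: cvg_Gamma_defect.
  case=> M [_ hM]; exists (M + 1) => n.
  by apply: hM => //; rewrite ltrDl.
have ge1 (c : R) : 1 <= c -> exists C : R, forall n, truncated_Gamma n c <= C.
  move=> c1; have c0 : 0 < c by exact: lt_le_trans c1.
  have [C hC] := defect_bounded c c0.
  have cp : 0 < c `^ (1 - c) by rewrite powR_gt0.
  exists ((c `^ (1 - c))^-1 * (1 + `|c `^ (1 - c) * ((1 - c) / c)| * C)) => n.
  rewrite mulrC ler_pdivlMr//.
  (* The exponent [1 - c] leads from [c] to 1. By the functional equation the coefficients of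
     [truncated_Gamma n c] add up to c^(1-c), and only a bounded defect term remains. *)
  have pc : (1 - c <= 0) || (1 <= 1 - c) by rewrite subr_le0 c1.
  have := truncated_Gamma_tangent n pc c0.
  rewrite (addrC c (1 - c)) subrK truncated_GammaD1.
  have -> : c `^ (1 - c) * (1 - (1 - c)) * truncated_Gamma n c +
    c `^ (1 - c) * ((1 - c) / c) * (c * truncated_Gamma n c + Gamma_defect n c) =
    truncated_Gamma n c * c `^ (1 - c) + c `^ (1 - c) * ((1 - c) / c) * Gamma_defect n c.
    by field; rewrite gt_eqF.
  set K := _ * (_ / c).
  have : - (K * Gamma_defect n c) <= `|K| * C.
    rewrite (le_trans (ler_norm _))// normrN normrM.
    by rewrite ler_wpM2l.
  by have := b1 n; lra.
have [C1 hC1] := ge1 (a + 1) ltac:(by rewrite lerDr ltW).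
have [C2 hC2] := defect_bounded a a0.
exists ((C1 + C2) / a) => n.
rewrite ler_pdivlMr// mulrC.
have := hC1 n; rewrite truncated_GammaD1.
have := hC2 n; have := ler_norm (- Gamma_defect n a); rewrite normrN.
by lra.
Qed.

Lemma bigcup_Gamma_itv : \bigcup_n Gamma_itv n = `]0 : R, +oo[.
Proof.
apply/seteqP; split => [u [n _ /Gamma_itv_gt0 u0]|u]; rewrite /= in_itv/= andbT// => u0.
pose m := maxn (Num.truncn u) (Num.truncn u^-1).
have hm v : 0 < v -> (Num.truncn v <= m)%N -> v <= m.+2%:R :> R.
  move=> v0 vm; have /andP[_ /ltW h] := truncn_itv (ltW v0).
  by apply: le_trans h _; rewrite ler_nat; lia.
exists m => //; rewrite /Gamma_itv/= in_itv/=; apply/andP; split.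
  rewrite -[leRHS]invrK lef_pV2 ?posrE ?ltr0n ?invr_gt0//.
  by apply: hm; rewrite ?invr_gt0// leq_maxr.
by apply: hm => //; rewrite leq_maxl.
Qed.

Lemma nondecreasing_Gamma_itv :
  {homo (@Gamma_itv R) : n m / (n <= m)%N >-> (n <= m)%O}.
Proof.
move=> n m nm; apply/subsetPset => u.
rewrite /Gamma_itv /= !in_itv/= => /andP[h1 h2]; apply/andP; split.
  by apply: le_trans h1; rewrite lef_pV2 ?posrE ?ltr0n// ler_nat.
by apply: le_trans h2 _; rewrite ler_nat.
Qed.

(** Monotone convergence holds in the extended reals; the uniform bound makes the limit finite, so
    that [Gamma a] is the true integral and not the default value 0. *)
Lemma cvg_truncated_Gamma a : 0 < a ->
  truncated_Gamma n a @[n --> \oo] --> Gamma a.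
Proof.
move=> a0; have [C hC] := truncated_Gamma_bounded a0.
have finI n : (truncated_Gamma n a)%:E =
    (\int[mu]_(u in Gamma_itv n) (Gamma_kernel a u)%:E)%E.
  rewrite /truncated_Gamma /Rintegral fineK//.
  exact: (integrable_fin_num (@measurable_Gamma_itv R n) (integrable_Gamma_kernel n a)).
have : (\int[mu]_(u in Gamma_itv n) (Gamma_kernel a u)%:E)%E @[n --> \oo] -->
    (\int[mu]_(u in \bigcup_n Gamma_itv n) (Gamma_kernel a u)%:E)%E.
  apply: ge0_nondecreasing_set_cvg_integral.
  - exact: nondecreasing_Gamma_itv.
  - exact: measurable_Gamma_itv.
  - by move=> n; have /integrableP[] := @integrable_Gamma_kernel R n a.
  - by move=> n u _; rewrite lee_fin Gamma_kernel_ge0.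
rewrite bigcup_Gamma_itv; under eq_fun do rewrite -finI.
set I := (\int[mu]_(u in _) _)%E => cvgI.
have I0 : (0 <= I)%E.
  by apply: integral_ge0 => u _; rewrite lee_fin Gamma_kernel_ge0.
have IC : (I <= C%:E)%E.
  apply: (cvge_to_le cvgI); near=> n; rewrite lee_fin; exact: hC.
have Ifin : I \is a fin_num by rewrite ge0_fin_numE// (le_lt_trans IC) ?ltry.
rewrite -(fineK Ifin) in cvgI.
exact: (fine_cvg cvgI).
Unshelve. all: by end_near. Qed.

Lemma Gamma1 : Gamma (1 : R) = 1.
Proof.
have h2 : truncated_Gamma n 1 @[n --> \oo] --> (1 : R).
  under eq_fun do rewrite truncated_Gamma1.
  have cexp : expR (- (n.+2%:R^-1 : R)) @[n --> \oo] --> expR (- 0).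
    apply: continuous_cvg; first exact: continuous_expR.
    by apply: cvgN; exact: cvg_invSS.
  have ck := @cvg_Gamma_kernelSS 0 (lexx 0).
  by have := cvgB cexp ck; rewrite add0r subr0 oppr0 expR0; apply.
exact: (cvg_unique _ (cvg_truncated_Gamma (@ltr01 R)) h2).
Qed.

Lemma GammaD1 a : 0 < a -> Gamma (a + 1) = a * Gamma a.
Proof.
move=> a0; have a10 : 0 < a + 1 by rewrite addr_gt0.
have h2 : truncated_Gamma n (a + 1) @[n --> \oo] --> a * Gamma a.
  under eq_fun do rewrite truncated_GammaD1.
  have := cvgD (cvgM (@cvg_cst R a _ \oo _) (cvg_truncated_Gamma a0))
    (cvg_Gamma_defect a0).
  by rewrite addr0; apply.
exact: (cvg_unique _ (cvg_truncated_Gamma a10) h2).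
Qed.

(* Integrated tangent line of [u `^ p] at [u = a]; the first-order term vanishes
   because [Gamma (a + 1) = a * Gamma a]. Applied to negative [p] and to [1 <= p],
   it replaces the log-convexity of [Gamma] and thus Hoelder's inequality. *)
Lemma Gamma_ge_powR a p : (p <= 0) || (1 <= p) -> 0 < a -> 0 < a + p ->
  a `^ p * Gamma a <= Gamma (a + p).
Proof.
move=> hp a0 ap0; have a10 : 0 < a + 1 by rewrite addr_gt0.
have h := cvg_truncated_Gamma.
have -> : a `^ p * Gamma a =
    a `^ p * (1 - p) * Gamma a + a `^ p * (p / a) * Gamma (a + 1).
  by rewrite GammaD1//; field; rewrite gt_eqF.
apply: (ler_cvg_to _ (h _ ap0)); last first.
  by near=> n; exact: truncated_Gamma_tangent.
by apply: cvgD; (apply: cvgM; [exact: cvg_cst|exact: h]).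
Unshelve. all: by end_near. Qed.

(** The tangent inequality at 1 with exponent [a + 1] gives [Gamma (a + 2) >= Gamma 1 = 1]; the
    functional equation then descends twice. *)
Lemma Gamma_gt0 a : 0 < a -> 0 < Gamma a.
Proof.
move=> a0; have a10 : 0 < a + 1 by rewrite addr_gt0.
have : 0 < Gamma (a + 1 + 1).
  have -> : a + 1 + 1 = 1 + (a + 1) by rewrite addrC.
  apply: lt_le_trans (Gamma_ge_powR _ _ _) => //.
  - by rewrite Gamma1 (_ : 1 `^ _ = 1) ?mulr1// powR1.
  - by rewrite lerDr (ltW a0) orbT.
  - by rewrite addr_gt0.
by rewrite !GammaD1// pmulr_rgt0// pmulr_rgt0.
Qed.

End Gamma_limit.

(** * Bounds for increments of the logarithm *)

Section logarithmic_inequalities.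
Context {R : realType}.
Implicit Types (a b t x : R).
Local Open Scope classical_set_scope.

Lemma ln_sub_le a b : 0 < a -> 0 < b -> ln b - ln a <= (b - a) / a.
Proof.
move=> a0 b0; rewrite -ln_div ?posrE// mulrBl divff ?gt_eqF//.
by apply: ln_le_subr1; rewrite divr_gt0.
Qed.

Lemma ln_sub_ge a b : 0 < a -> 0 < b -> (b - a) / b <= ln b - ln a.
Proof.
move=> a0 b0; rewrite -[leRHS]opprB lerNr (le_trans (ln_sub_le b0 a0))//.
by rewrite -mulNr opprB.
Qed.

Lemma le_of_ge0_derive (f df : R -> R) x : 0 <= x ->
  (forall t, 0 <= t -> is_derive t 1 f (df t)) ->
  (forall t, 0 <= t -> 0 <= df t) -> f 0 <= f x.
Proof.
rewrite le_eqVlt => /predU1P[<-//|x0] dfE df0.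
have [t| |c] := @MVT _ f df 0 x x0.
- by rewrite in_itv/= => /andP[/ltW t0 _]; exact: dfE.
- apply: derivable_within_continuous => t; rewrite in_itv/= => /andP[t0 _].
  by have [] := dfE t t0.
- rewrite in_itv/= subr0 => /andP[/ltW c0 _] fE.
  by rewrite -subr_ge0 fE mulr_ge0// ?df0// ltW.
Qed.

Lemma is_derive_lnD (a t : R) : 0 < a -> 0 <= t ->
  is_derive t 1 (fun s => ln (a + s)) (a + t)^-1.
Proof.
move=> a0 t0; have at0 : 0 < a + t by rewrite ltr_wpDr.
have dln := is_derive1_ln at0.
have dadd : is_derive t 1 (fun s : R => a + s) 1.
  rewrite -[X in is_derive _ _ _ X]add0r.
  exact: (is_deriveD (is_derive_cst a t 1) (is_derive_id t 1)).
by have := @is_derive1_comp _ (@ln R) (fun s => a + s) t _ _ dln dadd; rewrite mulr1.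
Qed.

Lemma ln_sub_ge_midpoint a x : 0 < a -> 0 <= x ->
  x / (x / 2 + a) <= ln (a + x) - ln a.
Proof.
move=> a0 x0.
have den t : 0 <= t -> 0 < t / 2 + a by move=> t0; lra.
(* This is [ln (a + t) - t / (t / 2 + a)], with the quotient written as
   [2 - 2 * a / (t / 2 + a)]. *)
pose f t : R := ln (a + t) - 2 + 2 * a * (t / 2 + a)^-1.
pose df t : R := (a + t)^-1 - a * (t / 2 + a) ^- 2.
have : f 0 <= f x.
  apply: (@le_of_ge0_derive _ df) => // t t0.
    have dln := is_derive_lnD a0 t0.
    have dden : is_derive t 1 (fun s : R => s / 2 + a) (t *: 0 + 2^-1 *: 1 + 0).
      have dM := is_deriveM (is_derive_id t 1) (is_derive_cst (2^-1 : R) t 1).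
      exact: (is_derive_eq (is_deriveD dM (is_derive_cst a t 1))).
    have dinv := @is_deriveV _ (fun s => s / 2 + a) t _ 1 (lt0r_neq0 (den _ t0)) dden.
    have dM := is_deriveM (is_derive_cst (2 * a) t 1) dinv.
    have dD := is_deriveD (is_deriveB dln (is_derive_cst (2 : R) t 1)) dM.
    apply: (is_derive_eq dD).
    rewrite /df /GRing.scale/=; field.
    by apply/andP; split; apply/lt0r_neq0; lra.
  have -> : df t = t ^+ 2 / 4 / ((a + t) * (t / 2 + a) ^+ 2).
    rewrite /df; field.
    by apply/andP; split; apply/lt0r_neq0; lra.
  by rewrite !divr_ge0// ?sqr_ge0// mulr_ge0 ?sqr_ge0// addr_ge0// ltW.
rewrite /f addr0 mul0r add0r -mulrA divff ?gt_eqF// mulr1.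
have -> : x / (x / 2 + a) = 2 - 2 * a * (x / 2 + a)^-1.
  by field; apply/lt0r_neq0; lra.
lra.
Qed.

(* Jensen: [1 / (t + 1 + k)] is the concave function [u / (1 + k u)] of
   [u = 1 / (t + 1)], whose mean over [0, x] is [ln (x + 1) / x]; the
   derivative of [f] below is the gap to the tangent at that mean. *)
Lemma ln_sub_le_logmean (k x : R) : 0 <= k -> 0 < x ->
  ln (1 + k + x) - ln (1 + k) <= x / (x / ln (x + 1) + k).
Proof.
move=> k0 x0.
pose v := ln (x + 1) / x.
have L0 : 0 < ln (x + 1) by rewrite ln_gt0// ltrDr.
have v0 : 0 < v by rewrite divr_gt0.
pose d := 1 + k * v; have d0 : 0 < d by rewrite ltr_wpDr// mulr_ge0// ltW.
(* The tangent to [u / (1 + k * u)] at [u = v] has value [v / d] and slope [d ^- 2]. Put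
   [u = 1 / (1 + t)], integrate in [t], and subtract [ln (1 + k + t)]. The middle term vanishes at
   [t = x] because [x * v = ln (x + 1)]. *)
pose f t : R := t * (v / d) + (ln (1 + t) - t * v) * d ^- 2 - ln (1 + k + t).
have k10 : 0 < 1 + k by rewrite ltr_wpDr.
have : f 0 <= f x.
  pose df t : R := v / d + ((1 + t)^-1 - v) * d ^- 2 - (1 + k + t)^-1.
  apply: (@le_of_ge0_derive _ df) => [|t t0|t t0]; first exact: ltW.
    have dln1 := is_derive_lnD (@ltr01 R) t0.
    have dlnk := is_derive_lnD k10 t0.
    have dv := is_deriveM (is_derive_id t 1) (is_derive_cst v t 1).
    have dvd := is_deriveM (is_derive_id t 1) (is_derive_cst (v / d) t 1).
    apply: (is_derive_eq (is_deriveB (is_deriveD dvd (is_deriveM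
      (is_deriveB dln1 dv) (is_derive_cst (d ^- 2) t 1))) dlnk)).
    by rewrite /df /GRing.scale/=; ring.
  have t10 : 0 < 1 + t by rewrite ltr_wpDr.
  have kt0 : 0 < 1 + k + t by rewrite ltr_wpDr.
  have -> : df t = k * (1 - v * (1 + t)) ^+ 2 / ((1 + t) * (1 + k + t) * d ^+ 2).
    rewrite /df /d; field.
    by rewrite !gt_eqF.
  apply: divr_ge0; first by rewrite mulr_ge0 ?sqr_ge0.
  by apply: ltW; rewrite !mulr_gt0// exprn_gt0.
rewrite /f !mul0r !addr0 ln1 subr0 mul0r !add0r.
have -> : ln (1 + x) - x * v = 0.
  by rewrite /v mulrC divfK ?gt_eqF// (addrC x) subrr.
have -> : x / (x / ln (x + 1) + k) = x * (v / d).
  rewrite /d /v; field.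
  by rewrite (gt_eqF x0) (gt_eqF L0) gt_eqF// ltr_wpDr// mulr_ge0// ltW.
by rewrite mul0r; lra.
Qed.

End logarithmic_inequalities.

(* Locked: otherwise unification of arithmetic terms unfolds the integral and
   the lattice of measure structures beneath it, which takes minutes. *)
HB.lock Definition ln_Gamma {R : realType} (y : R) : R := ln (Gamma y).

(** * Euler's limit for ln Gamma and convergence of the one for digamma *)

Section Euler_limits.
Context {R : realType}.
Implicit Types (h x y z : R) (n : nat).
Local Open Scope classical_set_scope.

Lemma le_ln x y : 0 < x -> x <= y -> ln x <= ln y.
Proof. by move=> x0 xy; rewrite ler_ln ?posrE// (lt_le_trans x0). Qed.

Lemma ln_mul x y : 0 < x -> 0 < y -> ln (x * y) = ln x + ln y.
Proof. by move=> x0 y0; rewrite lnM ?posrE. Qed.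

Lemma ln_GammaD1 y : 0 < y -> ln_Gamma (y + 1) = ln y + ln_Gamma y.
Proof.
by move=> y0; rewrite ln_Gamma.unlock GammaD1// (ln_mul y0 (Gamma_gt0 y0)).
Qed.

Lemma ln_Gamma_tangent y p : (p <= 0) || (1 <= p) -> 0 < y -> 0 < y + p ->
  p * ln y + ln_Gamma y <= ln_Gamma (y + p).
Proof.
move=> hp y0 yp0; rewrite ln_Gamma.unlock -ln_powR.
rewrite -(ln_mul (powR_gt0 p y0) (Gamma_gt0 y0)).
apply: le_ln; last exact: Gamma_ge_powR.
exact: (mulr_gt0 (powR_gt0 p y0) (Gamma_gt0 y0)).
Qed.

Lemma ln_GammaDn n y : 0 < y ->
  ln_Gamma (y + n%:R) = \sum_(k < n) ln (y + k%:R) + ln_Gamma y.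
Proof.
move=> y0; elim: n => [|n IHn]; first by rewrite addr0 big_ord0 add0r.
rewrite -[n.+1%:R]natr1.
rewrite addrA.
rewrite ln_GammaD1.
rewrite IHn.
rewrite big_ord_recr.
rewrite addrCA.
by rewrite addrA.
by rewrite ltr_wpDr.
Qed.

(** The tangent inequality taken backwards, from [y + h] with exponent [- h]. *)
Lemma ln_GammaD_le y h : 0 < y -> 0 <= h ->
  ln_Gamma (y + h) <= h * ln (y + h) + ln_Gamma y.
Proof.
move=> y0 h0; have yh0 : 0 < y + h by rewrite ltr_wpDr.
have hh : (- h <= 0) || (1 <= - h) by rewrite oppr_le0 h0.
have := ln_Gamma_tangent hh yh0; rewrite addrK mulNr => /(_ y0).
by lra.
Qed.

(** Exponents strictly between 0 and 1 are excluded, so the step from [y] is [1 + h]; the functional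
    equation absorbs one [ln y]. *)
Lemma ln_GammaD_ge y h : 0 < y -> 0 <= h ->
  h * ln y + ln_Gamma (y + 1) <= ln_Gamma (y + 1 + h).
Proof.
move=> y0 h0; have yh0 : 0 < y + (1 + h) by rewrite addr_gt0// ltr_wpDr.
have hh : (1 + h <= 0) || (1 <= 1 + h) by rewrite lerDl h0 orbT.
have := ln_Gamma_tangent hh y0 yh0.
by rewrite (ln_GammaD1 y0) addrA; lra.
Qed.

(* The indices run up to [n + 1] so that [1 - y] over [y + n + 1] is at most
   [1 / (n + 1)] for every [y > 0], in the proof of the first limit below. *)
Definition ln_Gamma_approx n y : R :=
  y * ln n.+2%:R - \sum_(k < n.+2) ln (y + k%:R).

(** The derivative of [ln_Gamma_approx n] at [y]. *)
Definition digamma_approx n y : R :=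
  ln n.+2%:R - \sum_(k < n.+2) (y + k%:R)^-1.

Lemma cvg_constM_harmonic (c : R) : c * (n.+1%:R^-1 : R) @[n --> \oo] --> 0.
Proof.
by rewrite -(mulr0 c); apply: cvgM; [exact: cvg_cst|exact: cvg_harmonic].
Qed.

(** Shift both arguments by [n + 2]: the increment of [ln_Gamma] then lies between
    [h * ln (y + n + 1)] and [h * ln (z + n + 2)], each [h * ln (n + 2)] up to O(1/n). Taking
    differences cancels the log-factorial term of Euler's formula, absent from [ln_Gamma_approx]. *)
Lemma cvg_ln_Gamma_approxB_le y z : 0 < y -> y <= z ->
  ln_Gamma_approx n z - ln_Gamma_approx n y @[n --> \oo] -->
  ln_Gamma z - ln_Gamma y.
Proof.
move=> y0 yz; pose h := z - y.
have h0 : 0 <= h by rewrite subr_ge0.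
have z0 : 0 < z by exact: lt_le_trans yz.
pose L := ln_Gamma z - ln_Gamma y.
have c1 : L - h * z * (n.+1%:R^-1 : R) @[n --> \oo] --> L.
  rewrite -[X in _ --> X]subr0.
  by apply: cvgB; [exact: cvg_cst|exact: cvg_constM_harmonic].
have c2 : L + h * (n.+1%:R^-1 : R) @[n --> \oo] --> L.
  rewrite -[X in _ --> X]addr0.
  by apply: cvgD; [exact: cvg_cst|exact: cvg_constM_harmonic].
apply: (squeeze_cvgr _ c1 c2); near=> n.
have yn0 : 0 < y + n.+1%:R by rewrite addr_gt0.
have hz m : z + m = y + m + h by rewrite /h; ring.
have n1 : y + n.+2%:R = y + n.+1%:R + 1 by rewrite -natr1 addrA.
have := ln_GammaD_le (addr_gt0 y0 (ltr0Sn R n.+1)) h0.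
have := ln_GammaD_ge yn0 h0.
rewrite -n1 -hz !ln_GammaDn// => lower upper.
have lnu : ln (z + n.+2%:R) - ln n.+2%:R <= z / n.+1%:R.
  apply: le_trans (ln_sub_le (ltr0Sn R n.+1) (addr_gt0 z0 (ltr0Sn R n.+1))) _.
  rewrite addrK ler_pM2l// lef_pV2 ?posrE//.
  by rewrite ler_nat.
have lnl : ln n.+2%:R - ln (y + n.+1%:R) <= n.+1%:R^-1.
  apply: le_trans (ln_sub_le yn0 (ltr0Sn R n.+1)) _.
  rewrite ler_pdivrMr// mulrDr mulVf ?pnatr_eq0//.
  have : 0 <= n.+1%:R^-1 * y by rewrite mulr_ge0// ?invr_ge0// ltW.
  move: (n.+1%:R^-1 * y) => q.
  by rewrite (_ : n.+2%:R = n.+1%:R + 1 :> R) ?natr1//; lra.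
have := ler_wpM2l h0 lnu; have := ler_wpM2l h0 lnl.
move: lower upper; rewrite /ln_Gamma_approx /L /h.
move: (\sum_(k < n.+2) ln (z + k%:R)) (\sum_(k < n.+2) ln (y + k%:R)) => Sz Sy.
move: (n.+1%:R^-1) (ln n.+2%:R) (ln (z + n.+2%:R)) (ln (y + n.+1%:R)) => q A B C.
move=> lower upper boundl boundu; apply/andP; split; nra.
Unshelve. all: by end_near. Qed.

Lemma cvg_ln_Gamma_approxB y z : 0 < y -> 0 < z ->
  ln_Gamma_approx n z - ln_Gamma_approx n y @[n --> \oo] -->
  ln_Gamma z - ln_Gamma y.
Proof.
move=> y0 z0; have [yz|/ltW zy] := leP y z; first exact: cvg_ln_Gamma_approxB_le.
rewrite -[X in _ --> X]opprB.
under eq_fun do rewrite -opprB.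
by apply: cvgN; exact: cvg_ln_Gamma_approxB_le.
Qed.

Lemma is_cvg_digamma_approx y : 0 < y -> cvgn (digamma_approx ^~ y).
Proof.
move=> y0.
(* With [ln (y + m)] in place of [ln m] the sequence is monotone; the correction tends to 0. *)
pose T m : R := ln (y + m%:R) - \sum_(k < m) (y + k%:R)^-1.
have ym m : 0 < y + m%:R by rewrite ltr_wpDr.
have TS m : T m.+1 - T m = ln (y + m.+1%:R) - ln (y + m%:R) - (y + m%:R)^-1.
  by rewrite /T big_ord_recr/=; ring.
have y1 m : y + m.+1%:R - (y + m%:R) = 1 by rewrite -natr1; ring.
have Tnoninc : nonincreasing_seq T.
  apply/nonincreasing_seqP => m; rewrite -subr_le0 TS subr_le0.
  by have := ln_sub_le (ym m) (ym m.+1); rewrite y1 mul1r.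
(* Each step lowers [T] by at most [(y + m)^-1 - (y + m + 1)^-1], which telescopes. *)
have Tlb m : T 0%N - y^-1 + (y + m%:R)^-1 <= T m.
  elim: m => [|m IHm]; first by rewrite addr0; lra.
  have := ln_sub_ge (ym m) (ym m.+1); rewrite y1 mul1r.
  by have := TS m; lra.
have cvgT : cvgn T.
  apply: nonincreasing_is_cvgn => //; exists (T 0%N - y^-1) => _ [m _ <-].
  by apply: le_trans (Tlb m); rewrite lerDl invr_ge0 ltW.
have cvgd : ln (y + n.+2%:R) - ln (n.+2%:R : R) @[n --> \oo] --> 0.
  apply: (squeeze_cvgr _ (@cvg_cst R 0 _ _ _) (cvg_constM_harmonic y)).
  near=> n; apply/andP; split.
    by rewrite subr_ge0 ler_ln ?posrE// lerDr ltW.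
  apply: le_trans (ln_sub_le (ltr0Sn R n.+1) (ym n.+2)) _.
  by rewrite addrK ler_pM2l// lef_pV2 ?posrE// ler_nat.
have cvgTS : T n.+2 @[n --> \oo] --> limn T.
  by move: cvgT; rewrite -(@cvg_shiftS R) -(@cvg_shiftS R); apply.
have -> : digamma_approx ^~ y =
    fun n => T n.+2 - (ln (y + n.+2%:R) - ln (n.+2%:R : R)).
  by apply/funext => n; rewrite /T /digamma_approx; ring.
by apply/cvg_ex; exists (limn T - 0); exact: (cvgB cvgTS cvgd).
Unshelve. all: by end_near. Qed.

End Euler_limits.

(** * Digamma as the limit of its approximants *)

Section digamma_limit.
Context {R : realType}.
Implicit Types (x y z : R) (n : nat).
Local Open Scope classical_set_scope.

Definition lim_digamma_approx y : R := limn (digamma_approx ^~ y).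

(** After the first term, each square is at most a telescoping difference of inverses. Uniformity in
    [n] lets the remainder bound below pass to the limit. *)
Lemma sum_sqr_inv_le n y : 0 < y ->
  \sum_(k < n) (y + k%:R) ^- 2 <= y ^- 2 + y^-1.
Proof.
move=> y0; have ym m : 0 < y + m%:R by rewrite ltr_wpDr.
case: n => [|n].
  by rewrite big_ord0 addr_ge0 ?invr_ge0 ?exprn_ge0 ?ltW.
apply: (@le_trans _ _ (y ^- 2 + y^-1 - (y + n%:R)^-1)); last first.
  by rewrite gerDl oppr_le0 invr_ge0 ltW.
elim: n => [|n IHn]; first by rewrite big_ord_recr big_ord0/= addr0; lra.
rewrite big_ord_recr/=; apply: le_trans (lerD IHn (lexx _)) _.
have : (y + n.+1%:R) ^- 2 <= (y + n%:R)^-1 - (y + n.+1%:R)^-1.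
  have -> : y + n.+1%:R = y + n%:R + 1 by rewrite -natr1 addrA.
  have := ym n; move: (y + n%:R) => u u0.
  rewrite -subr_ge0.
  have -> : u^-1 - (u + 1)^-1 - (u + 1) ^- 2 = (u * (u + 1) ^+ 2)^-1.
    by field; apply/andP; split; apply/lt0r_neq0; lra.
  by rewrite invr_ge0 mulr_ge0 ?exprn_ge0; lra.
lra.
Qed.

(** The logarithmic increment lies between [(z - y) / z] and [(z - y) / y]; their gap is
    [(z - y) ^+ 2 / (z * y)], and [y / 2 <= z] bounds [1 / z] by [2 / y]. *)
Lemma ln_sub_linear_bounds y z : 0 < y -> y / 2 <= z ->
  0 <= (z - y) / y - (ln z - ln y) <= 2 * (z - y) ^+ 2 / y ^+ 2.
Proof.
move=> y0 yz; have z0 : 0 < z by lra.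
apply/andP; split; first by rewrite subr_ge0 ln_sub_le.
have h := ln_sub_ge y0 z0.
have : (z - y) / y - (z - y) / z <= 2 * (z - y) ^+ 2 / y ^+ 2.
  rewrite -subr_ge0.
  have -> : 2 * (z - y) ^+ 2 / y ^+ 2 - ((z - y) / y - (z - y) / z) =
      (z - y) ^+ 2 * (2 * z - y) / (z * y ^+ 2).
    by field; rewrite !gt_eqF.
  apply: divr_ge0; first by rewrite mulr_ge0 ?sqr_ge0//; lra.
  by rewrite mulr_ge0 ?sqr_ge0// ltW.
lra.
Qed.

(** At the finite level the remainder is a sum of nonnegative terms, each bounded by
    [ln_sub_linear_bounds], since [y / 2 <= z] implies [(y + k) / 2 <= z + k]. *)
Lemma ln_Gamma_expansion y z : 0 < y -> y / 2 <= z ->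
  `|ln_Gamma z - ln_Gamma y - (z - y) * lim_digamma_approx y| <=
    2 * (y ^- 2 + y^-1) * (z - y) ^+ 2.
Proof.
move=> y0 yz; have z0 : 0 < z by lra.
have clim : ln_Gamma_approx n z - ln_Gamma_approx n y -
    (z - y) * digamma_approx n y @[n --> \oo] -->
    ln_Gamma z - ln_Gamma y - (z - y) * lim_digamma_approx y.
  apply: cvgB; first exact: cvg_ln_Gamma_approxB.
  by apply: cvgM; [exact: cvg_cst|exact: is_cvg_digamma_approx].
have sumE n : ln_Gamma_approx n z - ln_Gamma_approx n y -
    (z - y) * digamma_approx n y =
    \sum_(k < n.+2) ((z - y) / (y + k%:R) - (ln (z + k%:R) - ln (y + k%:R))).
  by rewrite !sumrB -mulr_sumr /ln_Gamma_approx /digamma_approx; ring.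
have bounds n (k : 'I_n.+2) :
    0 <= (z - y) / (y + k%:R) - (ln (z + k%:R) - ln (y + k%:R)) <=
    2 * (z - y) ^+ 2 * (y + k%:R) ^- 2.
  have k0 : (0 : R) <= k%:R by [].
  have := @ln_sub_linear_bounds (y + k%:R) (z + k%:R) ltac:(lra) ltac:(lra).
  by have -> : z + k%:R - (y + k%:R) = z - y by ring.
rewrite ger0_norm.
  apply: (cvgr_to_le clim); near=> n; rewrite sumE.
  apply: (@le_trans _ _ (\sum_(k < n.+2) 2 * (z - y) ^+ 2 * (y + k%:R) ^- 2)).
    by apply: ler_sum => k _; have /andP[] := bounds n k.
  rewrite -mulr_sumr mulrAC ler_wpM2r ?ler_wpM2l// ?sqr_ge0//.
  exact: sum_sqr_inv_le.
apply: (cvgr_to_ge clim); near=> n; rewrite sumE.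
by apply: sumr_ge0 => k _; have /andP[] := bounds n k.
Unshelve. all: by end_near. Qed.

Lemma is_derive_ln_Gamma y : 0 < y ->
  is_derive y 1 ln_Gamma (lim_digamma_approx y).
Proof.
move=> y0; pose C := 2 * (y ^- 2 + y^-1) + 1.
have C0 : 0 < C.
  by rewrite ltr_wpDl// mulr_ge0// addr_ge0 ?invr_ge0 ?sqr_ge0// ltW.
have quot : h^-1 *: ((ln_Gamma \o shift y) (h *: (1 : R)) - ln_Gamma y) @[h --> 0^']
    --> lim_digamma_approx y.
  apply/cvgrPdist_le => e e0; near=> h.
  have h0 : h != 0 by near: h; exact: nbhs_dnbhs_neq.
  have hy : `|h| < y / 2.
    near: h; by apply: dnbhs0_lt; rewrite divr_gt0.
  have he : `|h| < e / C.
    near: h; by apply: dnbhs0_lt; rewrite divr_gt0.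
  rewrite /= /GRing.scale/= mulr1.
  have yh : y / 2 <= h + y.
    by move: hy; rewrite ltr_norml => /andP[]; lra.
  have := ln_Gamma_expansion y0 yh; rewrite addrK => exp.
  have -> : lim_digamma_approx y - h^-1 * (ln_Gamma (h + y) - ln_Gamma y) =
      - h^-1 * (ln_Gamma (h + y) - ln_Gamma y - h * lim_digamma_approx y).
    by field.
  rewrite normrM normrN normfV ler_pdivrMl ?normr_gt0//.
  apply: le_trans exp _; rewrite -(real_normK (num_real h)) expr2 mulrCA ler_pM2l ?normr_gt0//.
  move: he; rewrite ltr_pdivlMr// => he.
  apply: ltW; apply: le_lt_trans he; rewrite mulrC ler_wpM2l// /C.
  by rewrite lerDl.
split; first by apply/cvg_ex; exists (lim_digamma_approx y).
exact: (cvg_lim _ quot).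
Unshelve. all: by end_near. Qed.

Lemma digammaE y : 0 < y -> digamma y = lim_digamma_approx y.
Proof.
move=> y0; have dln := is_derive_ln_Gamma y0.
have dexp := is_derive1_comp (is_derive_expR (ln_Gamma y)) dln.
have expK z : 0 < z -> expR (ln_Gamma z) = Gamma z.
  by move=> z0; rewrite ln_Gamma.unlock lnK// posrE Gamma_gt0.
(* [expR] inverts [ln] only at positive values, so the two functions are compared on a neighbourhood
   of [y], which determines the derivative. *)
have E : {near y, expR \o ln_Gamma =1 Gamma}.
  near=> z; apply: expK; near: z; exact: lt_nbhsr.
rewrite /digamma derive1E -(near_eq_derive _ E) ?oner_eq0//.
by rewrite derive_val/= expK// mulrC mulKf// gt_eqF// Gamma_gt0.
Unshelve. all: by end_near. Qed.

End digamma_limit.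

(** * Termwise comparison of the two limits *)

Theorem theorem2p5 (R : realType) (x : R) (hx : 0 < x) :
  expR (x * digamma (x / ln (x + 1))) <= Gamma (x + 1) /\
  Gamma (x + 1) <= expR (x * digamma (x / 2 + 1)).
Proof.
have x10 : 0 < x + 1 by rewrite addr_gt0.
have m0 : 0 < x / ln (x + 1) by rewrite divr_gt0// ln_gt0// ltrDr.
have m1 : 0 < x / 2 + 1 by rewrite addr_gt0// divr_gt0.
rewrite !digammaE//.
have -> : Gamma (x + 1) = expR (ln_Gamma (x + 1)).
  by rewrite ln_Gamma.unlock lnK// posrE Gamma_gt0.
have lnG1 : ln_Gamma (1 : R) = 0 by rewrite ln_Gamma.unlock Gamma1 ln1.
have climG := cvg_ln_Gamma_approxB (@ltr01 R) x10.
rewrite lnG1 subr0 in climG.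
have climd (y : R) : 0 < y ->
    (x * digamma_approx n y @[n --> \oo] --> x * lim_digamma_approx y)%classic.
  by move=> y0; apply: cvgM; [exact: cvg_cst|exact: is_cvg_digamma_approx].
have GE n : ln_Gamma_approx n (x + 1) - ln_Gamma_approx n 1 = x * ln n.+2%:R -
    \sum_(k < n.+2) (ln (1 + k%:R + x) - ln (1 + k%:R)).
  rewrite sumrB /ln_Gamma_approx.
  have -> : \sum_(k < n.+2) ln (x + 1 + k%:R) = \sum_(k < n.+2) ln (1 + k%:R + x).
    by apply: eq_bigr => k _; congr ln; ring.
  by ring.
have dE n (y : R) : x * digamma_approx n y =
    x * ln n.+2%:R - \sum_(k < n.+2) x / (y + k%:R).
  by rewrite /digamma_approx mulrBr mulr_sumr.
split; rewrite ler_expR.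
  (* The sums enter with a minus sign, so the lower bound on Gamma uses the upper bound on the
     logarithmic increments. *)
  apply: (ler_cvg_to (climd _ m0) climG); near=> n.
  rewrite GE dE lerB// ler_sum// => k _.
  exact: ln_sub_le_logmean.
apply: (ler_cvg_to climG (climd _ m1)); near=> n.
rewrite GE dE lerB// ler_sum// => k _.
(* Regrouped as [x / 2 + (1 + k)], the midpoint bound applies with [a = 1 + k]. *)
rewrite -addrA; apply: ln_sub_ge_midpoint; last exact: ltW.
by rewrite ltr_wpDr.
Unshelve. all: by end_near. Qed.
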